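(* Let $G$ be a $P$-group. Then $G$ is functionally balanced if and only if it is strongly functionally balanced.
   Context: All topological groups are assumed to be Hausdorff. A $P$-group is a topological group in which the intersection of countably many open sets is open. The left uniformity $\mathcal L_G$ of a topological group $G$ has as base the sets $\{(x,y)\in G^2: x^{-1}y\in U\}$, and the right uniformity $\mathcal R_G$ has as base the sets $\{(x,y)\in G^2: xy^{-1}\in U\}$, where $U$ runs over the neighborhoods of the identity. $G$ is functionally balanced if every bounded $\mathcal L_G$-uniformly continuous function $f:G\to\mathbb R$ is also $\mathcal R_G$-uniformly continuous. $G$ is strongly functionally balanced if every (not necessarily bounded) $\mathcal L_G$-uniformly continuous function $f:G\to\mathbb R$ is also $\mathcal R_G$-uniformly continuous. *)

(* Defs.v *)
From HB Require Import structures.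
From mathcomp Require Import all_boot all_order all_algebra.
From mathcomp Require Import all_classical all_reals all_analysis.
Import numFieldNormedType.Exports.

Set Implicit Arguments.
Unset Strict Implicit.
Unset Printing Implicit Defensive.

Local Open Scope classical_set_scope.
Local Open Scope group_scope.

(* Multiplicative, not necessarily commutative; the Hausdorff property is not
   part of the structure and is always assumed separately. *)
HB.mixin Record isTopologicalGroup G & Topological G & Group G := {
  mulg_continuous : continuous (fun x : G * G => x.1 * x.2) ;
  invg_continuous : continuous (fun x : G => x^-1) ;
}.

#[short(type="topologicalGroupType")]
HB.structure Definition TopologicalGroup :=
  {G of Topological G & Group G & isTopologicalGroup G}.

(* Finite intersections are covered by repeating terms. *)
Definition P_space (T : topologicalType) : Prop :=
  forall F : (set T)^nat, (forall n, open (F n)) -> open (\bigcap_n F n).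

Definition P_group (G : topologicalGroupType) : Prop :=
  hausdorff_space G /\ P_space G.

Definition left_entourage (G : topologicalGroupType) : set_system (G * G) :=
  filter_from (nbhs (1 : G)) (fun U => [set xy | U (xy.1^-1 * xy.2)]).

Definition right_entourage (G : topologicalGroupType) : set_system (G * G) :=
  filter_from (nbhs (1 : G)) (fun U => [set xy | U (xy.1 * xy.2^-1)]).

Section UniformityTheory.
Variable G : topologicalGroupType.
Implicit Types (x : G) (U : set G) (A : set (G * G)).

Lemma continuous_mull x : continuous (fun y : G => x * y).
Proof.
move=> y; apply: (@continuous_comp _ _ _ (fun y => (x, y))
  (fun z : G * G => z.1 * z.2)); last exact: mulg_continuous.
by apply: cvg_pair => /=; [exact: cvg_cst|exact: cvg_id].
Qed.

Lemma continuous_mulr x : continuous (fun y : G => y * x).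
Proof.
move=> y; apply: (@continuous_comp _ _ _ (fun y => (y, x))
  (fun z : G * G => z.1 * z.2)); last exact: mulg_continuous.
by apply: cvg_pair => /=; [exact: cvg_id|exact: cvg_cst].
Qed.

Lemma nbhs1_inv U : nbhs (1 : G) U -> nbhs (1 : G) [set x | U x^-1].
Proof. by move=> U1; apply: (@invg_continuous G 1); rewrite invg1. Qed.

Lemma nbhs1_split U : nbhs (1 : G) U ->
  exists2 V, nbhs (1 : G) V & forall x y, V x -> V y -> U (x * y).
Proof.
move=> U1.
have /= : nbhs ((1, 1) : G * G) [set z | U (z.1 * z.2)].
  by apply: (@mulg_continuous G (1, 1)); rewrite /= mulg1.
move=> [[V W] /= [V1 W1] VW]; exists (V `&` W); first exact: filterI.
by move=> x y [Vx _] [_ Wy]; apply: (VW (x, y)).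
Qed.

Lemma left_entourage_filter : Filter (@left_entourage G).
Proof.
apply: filter_from_filter; first by exists setT; exact: filterT.
by move=> U V U1 V1; exists (U `&` V); [exact: filterI|].
Qed.

Lemma right_entourage_filter : Filter (@right_entourage G).
Proof.
apply: filter_from_filter; first by exists setT; exact: filterT.
by move=> U V U1 V1; exists (U `&` V); [exact: filterI|].
Qed.

Lemma left_entourage_diagonal A : left_entourage A -> diagonal `<=` A.
Proof.
move=> [U U1 UA] [x y] /= xy; apply: UA => /=.
by rewrite -(xy : x = y) mulVg; exact: nbhs_singleton.
Qed.

Lemma right_entourage_diagonal A : right_entourage A -> diagonal `<=` A.
Proof.
move=> [U U1 UA] [x y] /= xy; apply: UA => /=.
by rewrite -(xy : x = y) mulgV; exact: nbhs_singleton.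
Qed.

Lemma left_entourage_inv A : left_entourage A -> left_entourage A^-1%relation.
Proof.
move=> [U U1 UA]; exists [set x | U x^-1]; first exact: nbhs1_inv.
by move=> [x y] /=; rewrite invgM invgK => Uyx; exact: (UA (y, x)).
Qed.

Lemma right_entourage_inv A :
  right_entourage A -> right_entourage A^-1%relation.
Proof.
move=> [U U1 UA]; exists [set x | U x^-1]; first exact: nbhs1_inv.
by move=> [x y] /=; rewrite invgM invgK => Uyx; exact: (UA (y, x)).
Qed.

Lemma left_entourage_split A : left_entourage A ->
  exists2 B, left_entourage B & (B \; B `<=` A)%relation.
Proof.
move=> [U /nbhs1_split[V V1 VU] UA].
exists [set xy | V (xy.1^-1 * xy.2)]; first by exists V.
move=> [x z] /= [y /= Vxy Vyz]; apply: UA => /=.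
by rewrite -[z](mulVKg y) mulgA; exact: VU.
Qed.

Lemma right_entourage_split A : right_entourage A ->
  exists2 B, right_entourage B & (B \; B `<=` A)%relation.
Proof.
move=> [U /nbhs1_split[V V1 VU] UA].
exists [set xy | V (xy.1 * xy.2^-1)]; first by exists V.
move=> [x z] /= [y /= Vxy Vyz]; apply: UA => /=.
by rewrite -[x](mulgVK y) -mulgA; exact: VU.
Qed.

Lemma left_entourage_nbhsE : @nbhs G G = nbhs_ (@left_entourage G).
Proof.
apply/funext => x; apply/seteqP; split => A.
  move=> Ax; exists [set xy | A (x * (xy.1^-1 * xy.2))].
    exists [set y | A (x * y)] => //.
    by apply: (@continuous_mull x 1); rewrite mulg1.
  by move=> y /xsectionP /=; rewrite mulVKg.
move=> [E [U U1 UE] EA].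
have : nbhs x [set y | U (x^-1 * y)].
  by apply: (@continuous_mull x^-1 x); rewrite mulVg.
by apply: filterS => y Uy; apply: EA; apply/xsectionP; exact: UE.
Qed.

Lemma right_entourage_nbhsE : @nbhs G G = nbhs_ (@right_entourage G).
Proof.
apply/funext => x; apply/seteqP; split => A.
  move=> Ax; exists [set xy | A ((xy.1 * xy.2^-1)^-1 * x)].
    exists [set y | A (y^-1 * x)] => //.
    apply: (@nbhs1_inv [set y | A (y * x)]).
    by apply: (@continuous_mulr x 1); rewrite mul1g.
  by move=> y /xsectionP /=; rewrite invgM invgK mulgVK.
move=> [E [U U1 UE] EA].
have xV : {for x, continuous (fun y : G => x * y^-1)}.
  apply: (@continuous_comp _ _ _ (fun y : G => y^-1) (fun y => x * y)).
    exact: invg_continuous.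
  exact: continuous_mull.
have : nbhs x [set y | U (x * y^-1)] by apply: xV; rewrite mulgV.
by apply: filterS => y Uy; apply: EA; apply/xsectionP; exact: UE.
Qed.

End UniformityTheory.

(* Aliases of G carrying the topology of G together with the left, resp.
   right, uniformity. *)
Definition left_uniform (G : topologicalGroupType) : Type := G.
Definition right_uniform (G : topologicalGroupType) : Type := G.

HB.instance Definition _ (G : topologicalGroupType) :=
  Topological.copy (left_uniform G) G.
HB.instance Definition _ (G : topologicalGroupType) :=
  Nbhs_isUniform_mixin.Build (left_uniform G)
    (@left_entourage_filter G) (@left_entourage_diagonal G)
    (@left_entourage_inv G) (@left_entourage_split G)
    (@left_entourage_nbhsE G).

HB.instance Definition _ (G : topologicalGroupType) :=
  Topological.copy (right_uniform G) G.
HB.instance Definition _ (G : topologicalGroupType) :=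
  Nbhs_isUniform_mixin.Build (right_uniform G)
    (@right_entourage_filter G) (@right_entourage_diagonal G)
    (@right_entourage_inv G) (@right_entourage_split G)
    (@right_entourage_nbhsE G).

Definition functionally_balanced (R : realType) (G : topologicalGroupType) :
    Prop :=
  forall f : G -> R, bounded_fun f ->
    unif_continuous (f : left_uniform G -> R) ->
    unif_continuous (f : right_uniform G -> R).

Definition strongly_functionally_balanced (R : realType)
    (G : topologicalGroupType) : Prop :=
  forall f : G -> R,
    unif_continuous (f : left_uniform G -> R) ->
    unif_continuous (f : right_uniform G -> R).

(* Main.v *)
(** In a P-group both entourage filters are closed under countable
    intersections, so a real function [f] is uniformly continuous exactly when
    [f x = f y] for all [(x, y)] in some entourage. This property is unchanged
    by composition with any injection of the reals, in particular with the
    bounded injection [atan]. *)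

Require Import Defs.
From HB Require Import structures.
From mathcomp Require Import all_boot all_order all_algebra.
From mathcomp Require Import all_classical all_reals all_analysis.

Set Implicit Arguments.
Unset Strict Implicit.
Unset Printing Implicit Defensive.

Import Order.TTheory GRing.Theory Num.Theory numFieldNormedType.Exports.

Local Open Scope classical_set_scope.
Local Open Scope ring_scope.

Lemma P_space_nbhs_bigcap (T : topologicalType) (x : T) (F : (set T)^nat) :
  P_space T -> (forall n, nbhs x (F n)) -> nbhs x (\bigcap_n F n).
Proof.
move=> PT xF; rewrite nbhsE; exists (\bigcap_n (F n)^°).
  by split; [apply: PT => n; exact: open_interior | move=> n _; exact: xF].
by move=> y Fy n _; apply: interior_subset; exact: Fy.
Qed.

(** Treats both group uniformities at once: [h] will be the map sending [(x, y)] to [x^-1 * y] or to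
    [x * y^-1], and preimages commute with intersections. *)
Lemma filter_from_nbhs_bigcap (T : topologicalType) (x : T) (S : Type)
    (h : S -> T) (F : nat -> set S) :
  P_space T -> (forall n, filter_from (nbhs x) (fun U => h @^-1` U) (F n)) ->
  filter_from (nbhs x) (fun U => h @^-1` U) (\bigcap_n F n).
Proof.
move=> PT EF; have /all_sig2[U xU UF] := fun n => cid2 (EF n).
exists (\bigcap_n U n); first exact: P_space_nbhs_bigcap.
by move=> s Us n _; apply: UF; exact: Us.
Qed.

Definition P_uniform (U : uniformType) : Prop :=
  forall F : nat -> set (U * U),
    (forall n, entourage (F n)) -> entourage (\bigcap_n F n).

Lemma P_group_left_uniform (G : topologicalGroupType) :
  P_group G -> P_uniform (left_uniform G).
Proof.
by move=> [_ PG] F; exact: (@filter_from_nbhs_bigcap G 1%g (G * G)%type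
  (fun xy => (xy.1^-1 * xy.2)%g)).
Qed.

Lemma P_group_right_uniform (G : topologicalGroupType) :
  P_group G -> P_uniform (right_uniform G).
Proof.
by move=> [_ PG] F; exact: (@filter_from_nbhs_bigcap G 1%g (G * G)%type
  (fun xy => (xy.1 * xy.2^-1)%g)).
Qed.

(** The entourages of [R] have a countable base whose intersection is the diagonal. Its preimages
    under [f] are countably many entourages of [U], so their intersection is still an entourage.
    Conversely, every entourage of [R] contains the diagonal. *)
Lemma P_uniform_unif_continuousE (R : realType) (U : uniformType) (f : U -> R) :
  P_uniform U ->
  unif_continuous f <-> entourage [set xy | f xy.1 = f xy.2].
Proof.
move=> PU; split=> [fuc|Ef]; last first.
  move=> A /entourage_refl AR; apply: filterS Ef => -[x y] /= fxy.
  by rewrite fxy; exact: AR.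
pose F n := [set xy : U * U | ball (f xy.1) n.+1%:R^-1 (f xy.2)].
have /PU : forall n, entourage (F n).
  move=> n; exact: (fuc _ (entourage_ball R n.+1%:R^-1%:pos)).
apply: filterS => -[x y] Fxy /=.
apply/eqP; apply: contraT; rewrite -subr_eq0 -normr_gt0 => fxy_gt0.
(* If [f x] and [f y] differ, some [N.+1%:R^-1] lies below their distance, against membership of
   [(x, y)] in [F N]. *)
have [N _ /(_ N (leqnn N))/=] := near_infty_natSinv_lt (PosNum fxy_gt0).
have := Fxy N I; rewrite /F /= -ball_normE /= => /lt_trans /[apply].
by rewrite ltxx.
Qed.

Lemma unif_continuous_atan (R : realType) (U : uniformType) (f : U -> R) :
  P_uniform U -> unif_continuous (atan \o f) <-> unif_continuous f.
Proof.
move=> PU; rewrite !P_uniform_unif_continuousE//.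
suff -> : [set xy : U * U | (atan \o f) xy.1 = (atan \o f) xy.2] =
          [set xy | f xy.1 = f xy.2] by [].
by apply/seteqP; split=> -[x y] /= => [/(can_inj (@atanK R))|->].
Qed.

Lemma bounded_fun_atan (R : realType) (T : Type) (f : T -> R) :
  bounded_fun (atan \o f).
Proof.
exists (pi / 2); split; first exact: num_real.
move=> M piM x _ /=; apply: le_trans (ltW piM).
by rewrite ler_norml !ltW ?atan_ltpi2 ?atan_gtNpi2.
Qed.

Theorem corollary2p11 (R : realType) (G : topologicalGroupType)
    (PG : P_group G) :
  functionally_balanced R G <-> strongly_functionally_balanced R G.
Proof.
split=> [FB f fL|SFB f _]; last exact: SFB.
(* The lemma on [atan] serves twice: here for the right uniformity, to reduce to a bounded function,
   and at the end for the left one, to return to the hypothesis on [f]. *)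
apply/(unif_continuous_atan _ (P_group_right_uniform PG)).
apply: (FB (atan \o f)); first exact: bounded_fun_atan.
exact/(unif_continuous_atan _ (P_group_left_uniform PG)).
Qed.
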